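(* Let $(A,d_A,Q)$ be a complete shifted $A_\infty$-algebra over a field $\mathbb{F}$, and let $Z^{-1}(A)$ be the space of degree $-1$ cocycles of $(A,d_A)$. The function $\bar\chi_1\colon Z^{-1}(A)\to\pi_1(\mathcal{N}_\bullet(A),0)$ defined by $\bar\chi_1(a):=[a\otimes\varphi_{[1]}]$ induces a group isomorphism $$H^{-1}(A)^{\circledast}\xrightarrow{\cong}\pi_1(\mathcal{N}_\bullet(A),0).$$
   Context: Conventions: $\mathbb{F}$ is a field of arbitrary characteristic; graded objects are $\mathbb{Z}$-graded and unbounded, differentials have degree $+1$, and the Koszul sign rule is used. A complete cochain complex is a cochain complex $(A,d_A)$ over $\mathbb{F}$ with a descending filtration by subcomplexes $A=\mathcal{F}_1A\supseteq\mathcal{F}_2A\supseteq\cdots$ such that $A=\varprojlim_n A/\mathcal{F}_nA$. For a graded vector space $V$ let $\bar T(V)=\bigoplus_{k\ge1}V^{\otimes k}$ with the deconcatenation coproduct. A complete shifted $A_\infty$-algebra $(A,d_A,Q)$ is a complete cochain complex with a degree $1$ coderivation $Q$ of $\bar T(A)$, $Q^2=0$, with structure maps $Q^1_n\colon A^{\otimes n}\to A$ (the restriction to $A^{\otimes n}$ of $Q$ followed by projection to $A$), such that $Q^1_1=d_A$ and $Q^1_n(\mathcal{F}_{i_1}A\otimes\cdots\otimes\mathcal{F}_{i_n}A)\subseteq\mathcal{F}_{i_1+\cdots+i_n}A$. $\mathrm{MC}_{\mathrm{As}}(A)=\{a\in A^0:\sum_{n\ge1}Q^1_n(a^{\otimes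 n})=0\}$. For a finite-dimensional dg associative algebra $(B,\delta,\cdot)$, $A\otimes B$ is a complete shifted $A_\infty$-algebra with filtration $\mathcal{F}_nA\otimes B$, differential $d_A\otimes\mathrm{id}+\mathrm{id}\otimes\delta$ (so $(\mathrm{id}\otimes\delta)(x\otimes b)=(-1)^{|x|}x\otimes\delta b$), and for $k\ge2$ structure maps $(x_1\otimes b_1,\dots,x_k\otimes b_k)\mapsto(-1)^{\sum_{i<j}|b_i||x_j|}Q^1_k(x_1,\dots,x_k)\otimes b_1\cdots b_k$. $N^\ast(\Delta^n)$ is the dg algebra of normalized $\mathbb{F}$-valued cochains on the standard $n$-simplex: basis $\varphi_\sigma$ dual to the nondegenerate simplices $\sigma=(i_0<\cdots<i_k)$, $\varphi_\sigma$ in degree $k$; $\varphi_{[n]}$ is the basis element of top degree $n$; $\delta\varphi_\sigma=\sum_\tau\sum_i(-1)^i c_{\tau,i}\varphi_\tau$ (sum over nondegenerate $(k+1)$-simplices $\tau$ and $0\le i\le k+1$, $c_{\tau,i}=1$ if $d_i\tau=\sigma$, else $0$); cup product $(\phi\smile\psi)(i_0<\cdots<i_{k+\ell})=\phi(i_0<\cdots<i_k)\psi(i_k<\cdots<i_{k+\ell})$. $N^\ast(\Delta^\bullet)$ is a simplicial dg algebra by restriction. The nerve of $A$ is the Kan simplicial set $\mathcal{N}_n(A)=\mathrm{MC}_{\mathrm{As}}(A\otimes N^\ast(\Delta^n))$. For $a\in Z^{-1}(A)$ the element $a\otimes\varphi_{[1]}$ is a $1$-simplex with both faces $0$. $\pi_1(\mathcal{N}_\bullet(A),0)$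 is the set of $\beta\in\mathcal{N}_1(A)$ with both faces $0$, modulo $\beta\sim\beta'$ if some $\eta\in\mathcal{N}_2(A)$ has $d_0\eta=\beta$, $d_1\eta=\beta'$, $d_2\eta=0$; the group operation is $[\alpha]\cdot[\beta]=[d_1\omega]$ for any $\omega\in\mathcal{N}_2(A)$ with $d_0\omega=\beta$, $d_2\omega=\alpha$. The product $\bar a\,\bar b:=\overline{Q^1_2(a,b)}$ makes $H^{-1}(A)$ a non-unital associative algebra. For a non-unital associative algebra $\bar R$, quasi-multiplication is $a\circledast b:=a+b+ab$; $a$ is quasi-invertible if there is $\check a\in\bar R$ with $a\circledast\check a=\check a\circledast a=0$; $\bar R^{\circledast}$ is the group of quasi-invertible elements under $\circledast$. (Every element of $H^{-1}(A)$ is quasi-invertible, so $H^{-1}(A)^{\circledast}=H^{-1}(A)$ as sets.) *)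

(* Defs.v *)
From HB Require Import structures.
From mathcomp Require Import all_boot all_order all_algebra.
From mathcomp Require Import generic_quotient.
From mathcomp Require Import all_classical.
Set Implicit Arguments.
Unset Strict Implicit.
Unset Printing Implicit Defensive.
Import Order.TTheory GRing.Theory Num.Theory.
Local Open Scope quotient_scope.
Local Open Scope classical_set_scope.
Local Open Scope ring_scope.

(* Modules given by a universal property.  [umod adm] is the free F-module on *)
(* X modulo the relations satisfied by every admissible map out of X: formal  *)
(* combinations [t : seq (F * X)] are identified when no admissible map       *)
(* separates them.  With [adm] = bilinear (on U * V) this is the tensor       *)
(* product; with [adm] = multilinear (on words) it is the tensor coalgebra.   *)

Section UniversalModule.
Variables (F : fieldType) (X : choiceType).
Variable adm : forall W : lmodType F, (X -> W) -> Prop.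

Definition fsum (W : lmodType F) (g : X -> W) (t : seq (F * X)) : W :=
  \sum_(p <- t) p.1 *: g p.2.

Definition feq (t u : seq (F * X)) : bool :=
  `[< forall (W : lmodType F) (g : X -> W), adm g -> fsum g t = fsum g u >].

Lemma feq_refl : reflexive feq.
Proof. by move=> t; apply/asboolP. Qed.

Lemma feq_sym : symmetric feq.
Proof.
by move=> t u; apply/asboolP/asboolP => h W g hg; rewrite (h W g hg).
Qed.

Lemma feq_trans : transitive feq.
Proof.
move=> u t v /asboolP h1 /asboolP h2; apply/asboolP => W g hg.
by rewrite (h1 W g hg) (h2 W g hg).
Qed.

Canonical feq_equiv := EquivRel feq feq_refl feq_sym feq_trans.

Definition umod : Type := {eq_quot feq}.
HB.instance Definition _ := Choice.on umod.
HB.instance Definition _ := Quotient.on umod.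
HB.instance Definition _ := EqQuotient.on umod.

Implicit Types x y z : umod.

(* The map out of [umod] induced by [g]; meaningful when [g] is admissible.   *)
Definition ulift (W : lmodType F) (g : X -> W) x : W := fsum g (repr x).

Definition ugen (a : X) : umod := \pi_umod [:: (1, a)].
Definition uzero : umod := \pi_umod [::].
Definition uadd x y : umod := \pi_umod (repr x ++ repr y).
Definition uscale (c : F) x : umod :=
  \pi_umod [seq (c * p.1, p.2) | p <- repr x].
Definition uopp x : umod := uscale (-1) x.

Lemma ulift_pi (W : lmodType F) (g : X -> W) t : adm g -> ulift g (\pi_umod t) = fsum g t.
Proof.
move=> hg; rewrite /ulift.
have /asboolP h : feq (repr (\pi_umod t)) t by apply/eqmodP; rewrite -/umod reprK.
exact: h.
Qed.

Lemma umodP x y :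
  (forall (W : lmodType F) (g : X -> W), adm g -> ulift g x = ulift g y) -> x = y.
Proof.
move=> h; rewrite -[x]reprK -[y]reprK; apply/eqmodP/asboolP => W g hg.
exact: h.
Qed.

Lemma ulift0 (W : lmodType F) (g : X -> W) : adm g -> ulift g uzero = 0.
Proof. by move=> hg; rewrite ulift_pi // /fsum big_nil. Qed.

Lemma uliftD (W : lmodType F) (g : X -> W) x y :
  adm g -> ulift g (uadd x y) = ulift g x + ulift g y.
Proof. by move=> hg; rewrite ulift_pi // /fsum big_cat. Qed.

Lemma uliftZ (W : lmodType F) (g : X -> W) c x :
  adm g -> ulift g (uscale c x) = c *: ulift g x.
Proof.
move=> hg; rewrite ulift_pi // /ulift /fsum big_map scaler_sumr.
by apply: eq_bigr => p _; rewrite scalerA.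
Qed.

Lemma uaddA : associative uadd.
Proof. by move=> x y z; apply: umodP => W g hg; rewrite !uliftD // addrA. Qed.

Lemma uaddC : commutative uadd.
Proof. by move=> x y; apply: umodP => W g hg; rewrite !uliftD // addrC. Qed.

Lemma uadd0 : left_id uzero uadd.
Proof.
by move=> x; apply: umodP => W g hg; rewrite uliftD // ulift0 // add0r.
Qed.

Lemma uaddN : left_inverse uzero uopp uadd.
Proof.
move=> x; apply: umodP => W g hg.
by rewrite uliftD // ulift0 // uliftZ // scaleN1r addNr.
Qed.

HB.instance Definition _ := GRing.isZmodule.Build umod uaddA uaddC uadd0 uaddN.

Lemma uscaleA a b x : uscale a (uscale b x) = uscale (a * b) x.
Proof. by apply: umodP => W g hg; rewrite !uliftZ // scalerA. Qed.

Lemma uscale1 : left_id 1 uscale.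
Proof. by move=> x; apply: umodP => W g hg; rewrite uliftZ // scale1r. Qed.

Lemma uscaleDr : right_distributive uscale +%R.
Proof.
by move=> c x y; apply: umodP => W g hg; rewrite !(uliftZ, uliftD) // scalerDr.
Qed.

Lemma uscaleDl x : {morph uscale^~ x : a b / a + b}.
Proof.
by move=> a b; apply: umodP => W g hg; rewrite !(uliftZ, uliftD) // scalerDl.
Qed.

HB.instance Definition _ := GRing.Zmodule_isLmodule.Build F umod
  uscaleA uscale1 uscaleDr uscaleDl.

End UniversalModule.

Section TensorProduct.
Variables (F : fieldType) (U V : lmodType F).

Definition bilinear_map (W : lmodType F) (g : U * V -> W) : Prop :=
  (forall c u u' v, g (c *: u + u', v) = c *: g (u, v) + g (u', v)) /\
  (forall c u v v', g (u, c *: v + v') = c *: g (u, v) + g (u, v')).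

Definition tensor : Type := umod bilinear_map.
HB.instance Definition _ := GRing.Lmodule.on tensor.

Definition tens (u : U) (v : V) : tensor := ugen bilinear_map (u, v).

End TensorProduct.

(* The word [:: x_1; ...; x_k] stands for x_1 (x) ... (x) x_k.  Requiring     *)
(* admissible maps to vanish on the empty word removes the summand k = 0.     *)
Section TensorCoalgebra.
Variables (F : fieldType) (A : lmodType F).

Definition multilinear_map (W : lmodType F) (g : seq A -> W) : Prop :=
  g [::] = 0 /\
  forall (u v : seq A) (c : F) (x y : A),
    g (u ++ (c *: x + y) :: v) = c *: g (u ++ x :: v) + g (u ++ y :: v).

Definition tcoalg : Type := umod multilinear_map.
HB.instance Definition _ := GRing.Lmodule.on tcoalg.

Definition word (w : seq A) : tcoalg := ugen multilinear_map w.

Definition tproj1 (t : tcoalg) : A :=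
  ulift (fun w : seq A => if w is [:: x] then x else 0) t.

Definition deconc (t : tcoalg) : tensor tcoalg tcoalg :=
  ulift (fun w : seq A =>
    \sum_(1 <= i < size w) tens (word (take i w)) (word (drop i w))) t.

End TensorCoalgebra.

(* A graded space is the total space of the direct sum of its homogeneous     *)
(* parts, with the projections onto them.                                     *)
Record graded (F : fieldType) := Graded {
  gr_sort :> lmodType F;
  gr_proj : int -> {linear gr_sort -> gr_sort};
  gr_projK : forall i j x,
    gr_proj i (gr_proj j x) = if i == j then gr_proj j x else 0;
  gr_fin : forall x, finite_set [set i | gr_proj i x != 0];
  gr_sum : forall x, x = \sum_(i \in [set: int]) gr_proj i x }.

Section GradedTheory.
Variables (F : fieldType) (A : graded F).

Definition hom (i : int) : set A := [set x | gr_proj A i x = x].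

(* (-1)^(p |x|) x on homogeneous x, extended linearly: the Koszul sign of     *)
(* moving something of degree p past x.                                       *)
Definition koszul (p : int) (x : A) : A :=
  \sum_(i \in [set: int]) (-1) ^+ `|(p * i)%R|%N *: gr_proj A i x.

Definition tkoszul (p : int) (t : tcoalg A) : tcoalg A :=
  ulift (fun w : seq A => word (map (koszul p) w)) t.

Definition hom_word (k : int) (w : seq A) : Prop :=
  exists ks : seq int, [/\ size ks = size w,
    forall j, (j < size w)%N -> hom (nth 0 ks j) (nth 0 w j) &
    \sum_(i <- ks) i = k].

Definition thom (k : int) : set (tcoalg A) :=
  [set t | exists s : seq (F * seq A),
    (forall p, p \in s -> hom_word k p.2) /\
    t = \sum_(p <- s) p.1 *: word p.2].

Definition degree1 (Q : tcoalg A -> tcoalg A) : Prop :=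
  forall k t, thom k t -> thom (k + 1) (Q t).

(* Delta Q = (Q (x) id + id (x) Q) Delta, with the Koszul sign in id (x) Q.   *)
Definition coderivation1 (Q : tcoalg A -> tcoalg A) : Prop :=
  forall t, deconc (Q t) =
    ulift (fun p : tcoalg A * tcoalg A =>
             tens (Q p.1) p.2 + tens (tkoszul 1 p.1) (Q p.2)) (deconc t).

End GradedTheory.

(* [filt n] is the n-th step for n >= 1; [filt 0] is then the whole space too.*)
(* The inverse limit is that of graded spaces, taken degreewise: an element   *)
(* of lim_n A^i / F_n A^i is represented by a sequence [u] in A^i with        *)
(* u (n + 1) = u n modulo F_n, so the last two fields say that A^i -> lim is  *)
(* injective and surjective.                                                  *)
Record complete_complex (F : fieldType) := CompleteComplex {
  cc_sort :> graded F;
  cc_d : {linear cc_sort -> cc_sort};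
  cc_d_deg : forall i x, hom i x -> hom (i + 1) (cc_d x);
  cc_dd : forall x, cc_d (cc_d x) = 0;
  cc_filt : nat -> set cc_sort;
  cc_filt1 : cc_filt 1%N = setT;
  cc_filtS : forall n, cc_filt n.+1 `<=` cc_filt n;
  cc_filt_lin : forall n c x y,
    cc_filt n x -> cc_filt n y -> cc_filt n (c *: x + y);
  cc_filt0 : forall n, cc_filt n 0;
  cc_filt_gr : forall n i x, cc_filt n x -> cc_filt n (gr_proj cc_sort i x);
  cc_filt_d : forall n x, cc_filt n x -> cc_filt n (cc_d x);
  cc_lim_inj : forall i x, hom i x -> (forall n, cc_filt n x) -> x = 0;
  cc_lim_surj : forall i (u : nat -> cc_sort),
    (forall n, hom i (u n)) -> (forall n, cc_filt n (u n.+1 - u n)) ->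
    exists2 x, hom i x & forall n, cc_filt n (x - u n) }.

(* Q^1_n(x_1, ..., x_n), as a function of the word x_1 ... x_n.               *)
Definition structure_map (F : fieldType) (A : lmodType F)
  (Q : tcoalg A -> tcoalg A) (w : seq A) : A := tproj1 (Q (word w)).

Record complete_ainf (F : fieldType) := CompleteAinf {
  ca_sort :> complete_complex F;
  ca_Q : {linear tcoalg ca_sort -> tcoalg ca_sort};
  ca_Q_deg : degree1 (A := ca_sort) ca_Q;
  ca_Q_coder : coderivation1 (A := ca_sort) ca_Q;
  ca_QQ : forall t, ca_Q (ca_Q t) = 0;
  ca_Q1 : forall x, structure_map ca_Q [:: x] = cc_d ca_sort x;
  ca_Q_filt : forall (w : seq ca_sort) (s : seq nat),
    w != [::] -> size s = size w -> all (leq 1) s ->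
    (forall j, (j < size w)%N -> cc_filt (nth 0%N s j) (nth 0 w j)) ->
    cc_filt (sumn s) (structure_map ca_Q w) }.

(* Everything the Maurer-Cartan set depends on.                               *)
Record ainf_data (F : fieldType) := AinfData {
  ad_sort :> lmodType F;
  ad_hom : int -> set ad_sort;
  ad_filt : nat -> set ad_sort;
  ad_map : seq ad_sort -> ad_sort }.

(* \sum_(n >= 1) u n = l in the topology of the filtration [Fil].             *)
Definition filt_series (F : fieldType) (V : lmodType F) (Fil : nat -> set V)
    (u : nat -> V) (l : V) : Prop :=
  forall N, exists M, forall m, (M <= m)%N ->
    Fil N (\sum_(1 <= n < m.+1) u n - l).

Definition MC (F : fieldType) (D : ainf_data F) : set D :=
  [set a | ad_hom 0 a /\
           filt_series (@ad_filt F D) (fun n => ad_map (nseq n a)) 0].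

(* The operations of a finite-dimensional dg algebra B with a homogeneous     *)
(* basis indexed by [dg_basis]; B itself is {ffun dg_basis -> F}.             *)
Record dg_ops (F : fieldType) := DgOps {
  dg_basis : finType;
  dg_deg : dg_basis -> int;
  dg_diff : {ffun dg_basis -> F} -> {ffun dg_basis -> F};
  dg_mul : {ffun dg_basis -> F} -> {ffun dg_basis -> F} ->
           {ffun dg_basis -> F} }.

Section TensorAinf.
Variables (F : fieldType) (A : complete_ainf F) (B : dg_ops F).
Local Notation I := (dg_basis B).

Definition dg_e (i : I) : {ffun I -> F} := [ffun j => (i == j)%:R].

Definition dg_prod (bs : seq {ffun I -> F}) : {ffun I -> F} :=
  if bs is b :: bs' then foldl (@dg_mul F B) b bs' else 0.

(* A (x) B is {ffun I -> A}, where f stands for \sum_i f i (x) e_i.           *)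
Definition pure (x : A) (b : {ffun I -> F}) : {ffun I -> A} :=
  [ffun i => b i *: x].

Definition tensor_diff (f : {ffun I -> A}) : {ffun I -> A} :=
  \sum_i pure (cc_d A (f i)) (dg_e i) +
  \sum_i pure (koszul 1 (f i)) (dg_diff (dg_e i)).

(* The multilinear extension of the structure maps: the j-th argument is      *)
(* expanded as \sum_i fs_j i (x) e_i, and its A-part is moved past the        *)
(* B-parts of the previous arguments.                                         *)
Definition tensor_map (fs : seq {ffun I -> A}) : {ffun I -> A} :=
  if fs is [:: f] then tensor_diff f else
  \sum_(s : (size fs).-tuple I)
    pure (structure_map (ca_Q A)
           [seq koszul (\sum_(i < size fs | (i < j)%N) dg_deg (tnth s i))
                       (nth 0 fs j (tnth s j)) | j : 'I_(size fs)])
         (dg_prod [seq dg_e i | i <- s]).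

Definition tensor_ainf : ainf_data F := {|
  ad_sort := {ffun I -> A};
  ad_hom := fun k => [set f | forall i, hom (k - dg_deg i) (f i)];
  ad_filt := fun n => [set f | forall i, cc_filt n (f i)];
  ad_map := tensor_map |}.

End TensorAinf.

(* A nondegenerate simplex of Delta^n is given by its nonempty set of         *)
(* vertices.                                                                  *)
Definition simplex (n : nat) : finType := {s : {set 'I_n.+1} | s != finset.set0}.

Definition dim n (s : simplex n) : nat := #|val s|.-1.

(* Value of a cochain on a set of vertices (0 on the empty set).              *)
Definition cochain_at n (V : nmodType) (c : {ffun simplex n -> V})
  (s : {set 'I_n.+1}) : V := oapp c 0 (insub s).

(* The vertex set of d_i s: [enum] lists the vertices in increasing order.    *)
Definition omit_vertex n (s : {set 'I_n.+1}) (i : nat) : {set 'I_n.+1} :=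
  s :\ nth ord0 (enum s) i.

Section Cochains.
Variables (F : fieldType) (n : nat).
Implicit Types phi psi : {ffun simplex n -> F}.

Definition cochain_diff phi : {ffun simplex n -> F} :=
  [ffun t : simplex n => \sum_(s : simplex n) phi s *
     \sum_(i < #|val t|) (-1) ^+ i * (omit_vertex (val t) i == val s)%:R].

(* For phi of degree k and psi of degree l only the splitting of a            *)
(* (k + l)-simplex at its k-th vertex contributes.                            *)
Definition cup phi psi : {ffun simplex n -> F} :=
  [ffun t : simplex n => \sum_(v in val t)
     cochain_at phi [set w in val t | (w <= v)%N]%SET *
     cochain_at psi [set w in val t | (v <= w)%N]%SET].

Definition Ncochains : dg_ops F := {|
  dg_basis := simplex n;
  dg_deg := fun s => (dim s)%:Z;
  dg_diff := cochain_diff;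
  dg_mul := cup |}.

Definition phi_top : {ffun simplex n -> F} :=
  [ffun s : simplex n => (val s == [set: 'I_n.+1]%SET)%:R].

End Cochains.

Section Nerve.
Variables (F : fieldType) (A : complete_ainf F).

Definition AN (n : nat) : ainf_data F := tensor_ainf A (Ncochains F n).

Definition nerve (n : nat) : set (AN n) := @MC F (AN n).

(* Restriction along a map of vertices; normalized cochains vanish on         *)
(* degenerate simplices.                                                      *)
Definition pullback m n (theta : 'I_m.+1 -> 'I_n.+1) (f : AN n) : AN m :=
  [ffun s : simplex m =>
     if #|theta @: val s| == #|val s| then cochain_at f (theta @: val s)
     else 0].

Definition face n (i : 'I_n.+2) (f : AN n.+1) : AN n := pullback (lift i) f.

Definition loop (b : AN 1) : Prop :=
  [/\ nerve b, face (inord 0) b = 0 & face (inord 1) b = 0].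

Definition loop_equiv (b b' : AN 1) : Prop :=
  exists2 eta : AN 2, nerve eta &
    [/\ face (inord 0) eta = b, face (inord 1) eta = b' &
        face (inord 2) eta = 0].

Definition loop_class (b : AN 1) : set (AN 1) :=
  [set b' | loop b' /\ loop_equiv b b'].

Definition pi1 : set (set (AN 1)) := [set loop_class b | b in loop].

(* The union of the classes [d_1 omega] over all omega with d_2 omega in x    *)
(* and d_0 omega in y; it is a single class exactly when such an omega exists *)
(* and [d_1 omega] does not depend on the choices.                            *)
Definition pi1_mul (x y : set (AN 1)) : set (AN 1) :=
  [set g | exists omega : AN 2,
     [/\ nerve omega, x (face (inord 2) omega), y (face (inord 0) omega) &
         loop_class (face (inord 1) omega) g]].

Definition Zm1 : set A := [set a | hom (- 1) a /\ cc_d A a = 0].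

Definition chi1 (a : A) : set (AN 1) :=
  loop_class (pure (B := Ncochains F 1) a (phi_top F 1)).

(* H^{-1}(A): cohomology classes are cosets, with elementwise operations.     *)
Definition coh (a : A) : set A :=
  [set a' | exists2 c, hom (- 2) c & a' = a + cc_d A c].

Definition Hm1 : set (set A) := [set coh a | a in Zm1].

Definition coh_add (x y : set A) : set A := [set a + b | a in x & b in y].

Definition coh_mul (x y : set A) : set A :=
  [set z | exists a b, [/\ x a, y b & coh (structure_map (ca_Q A) [:: a; b]) z]].

Definition quasi_mul (x y : set A) : set A :=
  coh_add (coh_add x y) (coh_mul x y).

Definition Hm1_quasi : set (set A) :=
  [set x | Hm1 x /\ exists2 y, Hm1 y &
           quasi_mul x y = coh 0 /\ quasi_mul y x = coh 0].

End Nerve.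
Arguments Zm1 [F] A _.
Arguments Hm1 [F] A _.
Arguments Hm1_quasi [F] A _.
Arguments pi1 [F] A _.
Arguments chi1 [F] A a _.
Arguments coh [F] A a _.
Arguments pi1_mul [F] A x y _.
Arguments quasi_mul [F] A x y _.

Definition is_group (T : Type) (G : set T) (op : T -> T -> T) : Prop :=
  [/\ forall x y, G x -> G y -> G (op x y),
      forall x y z, G x -> G y -> G z -> op x (op y z) = op (op x y) z &
      exists2 e, G e &
        forall x, G x -> [/\ op e x = x, op x e = x &
          exists2 y, G y & op x y = e /\ op y x = e]].

Definition group_iso (T U : Type) (G : set T) (opG : T -> T -> T)
    (H : set U) (opH : U -> U -> U) (f : T -> U) : Prop :=
  [/\ is_group G opG, is_group H opH, set_bij G H f &
      forall x y, G x -> G y -> f (opG x y) = opH (f x) (f y)].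

(* Main.v *)
Require Import Defs.
From mathcomp Require Import all_boot all_order all_algebra.
From mathcomp Require Import all_classical.
Set Implicit Arguments.
Unset Strict Implicit.
Unset Printing Implicit Defensive.
Import Order.TTheory GRing.Theory Num.Theory.
(* Gives [hom] back its meaning of homogeneous elements. *)
Import Defs.
Local Open Scope classical_set_scope.
Local Open Scope ring_scope.

(** Write [a b] for [Q^1_2(a, b)].

A [1]-simplex of the nerve with both faces [0] vanishes on the vertices of
[Delta^1], so it is [a (x) phi_top] with [a] of degree -1, and the
Maurer-Cartan equation reduces to [d a = 0] ([loopP]).  A [2]-simplex [w] whose
vertices vanish has edges [w01], [w02], [w12] of degree -1 and a filling [y] of
degree -2.  A product of positive-degree cochains on [Delta^2] vanishes from
three factors on, and the only nonzero product of two edges is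
[phi_01 phi_12 = phi_012].  So the Maurer-Cartan series stops after the binary
operation, and on the triangle it reads, Koszul signs included,

  [d y + w02 - (w01 + w12 + w01 w12) = 0]   ([triangle_curvature]).

Both the homotopy relation and the product of [pi_1] can be read off from this
equation ([triangleP]).  With [w01 = 0], two loops are homotopic exactly when
they differ by a coboundary; in general, the product of the classes of [a] and
[b] is the class of [a + b + a b].  Hence taking the direct image along
[a |-> a (x) phi_top] maps [H^(-1)] bijectively onto [pi_1] and carries
quasi-multiplication to the product of loops.

It remains to see that [H^(-1)] is a group under quasi-multiplication and that
all its elements are quasi-invertible; the group structure on [pi_1] is then
transported ([group_iso_transport]).  The product on cohomology is well defined
and associative by the relations [Q^2 = 0] in arities two and three
([ainf_rel2], [ainf_rel3], [m2_assoc]).  These are derived from the coderivation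
property: an element of the tensor coalgebra is determined by its projection to
[A] and its coproduct ([tcoalg_split]), which expresses [Q] on short words
through the structure maps.  Inverses exist by completeness: the solution of
[a + b + a b = 0] is the limit of the iterates of [b |-> - a - a b]
([quasi_right_inverse]). *)

(** * Linear maps out of universal modules *)

Lemma linear_at0 (F : fieldType) (U V : lmodType F) (h : U -> V) :
  linear h -> h 0 = 0.
Proof.
by move=> hl; have := hl (-1) 0 0; rewrite scaleN1r addNr scaleN1r addNr.
Qed.

Lemma linear_sum (F : fieldType) (U V : lmodType F) (h : U -> V) :
  linear h -> forall (I : Type) (r : seq I) (P : pred I) (E : I -> U),
  h (\sum_(i <- r | P i) E i) = \sum_(i <- r | P i) h (E i).
Proof.
move=> hl I r P E; apply: (big_morph h); last exact: linear_at0.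
by move=> x y; rewrite -[x]scale1r hl !scale1r.
Qed.

Section UniversalModule.
Variables (F : fieldType) (X : choiceType).
Variable adm : forall W : lmodType F, (X -> W) -> Prop.

Lemma ulift_gen (W : lmodType F) (g : X -> W) a :
  adm g -> ulift g (ugen adm a) = g a.
Proof. by move=> hg; rewrite ulift_pi // /fsum big_seq1 scale1r. Qed.

Lemma ulift_linear (W : lmodType F) (g : X -> W) :
  adm g -> linear (ulift (adm := adm) g).
Proof. by move=> hg c x y; rewrite [LHS]uliftD // uliftZ. Qed.

Lemma ulift_at0 (W : lmodType F) (g : X -> W) :
  adm g -> ulift (adm := adm) g 0 = 0.
Proof. exact: ulift0. Qed.

(** A universal module is spanned by its generators, so a linear map out of it
is determined by their images. *)
Lemma umod_ext (W : lmodType F) (h h' : umod adm -> W) :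
  linear h -> linear h' -> (forall a, h (ugen adm a) = h' (ugen adm a)) ->
  h =1 h'.
Proof.
move=> hl hl' e x.
have -> : x = \sum_(p <- repr x) p.1 *: ugen adm p.2.
  apply: umodP => W' g hg; rewrite {1}/ulift /fsum.
  elim: (repr x) => [|p s IH]; first by rewrite !big_nil ulift_at0.
  by rewrite !big_cons ulift_linear // ulift_gen // IH.
elim: (repr x) => [|p s IH]; first by rewrite !big_nil !linear_at0.
by rewrite !big_cons hl hl' IH e.
Qed.

End UniversalModule.

(** * The tensor coalgebra is rebuilt from its projection and coproduct *)

Section TensorCoalgebra.
Variables (F : fieldType) (A : lmodType F).

Lemma tens_bilinear (U V : lmodType F) :
  bilinear_map (fun p : U * V => tens p.1 p.2).
Proof.
split=> c u u' v; apply: umodP => W g hg; rewrite ulift_linear // !ulift_gen //.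
  by rewrite hg.1.
by rewrite hg.2.
Qed.

Lemma word_multilinear : multilinear_map (@word F A).
Proof.
split=> [|u v c x y]; apply: umodP => W g hg.
  by rewrite ulift_gen // ulift_at0 // hg.1.
by rewrite ulift_linear // !ulift_gen // hg.2.
Qed.

Lemma tproj1_multilinear :
  multilinear_map (fun w : seq A => if w is [:: x] then x else 0).
Proof.
split=> // -[|a [|b u]] [|e v] c x y //=; rewrite ?scaler0 ?addr0 //.
Qed.

Lemma tproj1_word (w : seq A) :
  tproj1 (word w) = if w is [:: x] then x else 0.
Proof. exact: (ulift_gen w tproj1_multilinear). Qed.

Lemma tproj1_linear : linear (@tproj1 F A).
Proof. exact: ulift_linear tproj1_multilinear. Qed.

Lemma deconc_multilinear :
  multilinear_map (fun w : seq A =>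
    \sum_(1 <= i < size w) tens (word (take i w)) (word (drop i w))).
Proof.
have [tl tr] := tens_bilinear (tcoalg A) (tcoalg A); rewrite /= in tl tr.
split=> [|u v c x y]; first by rewrite big_geq.
rewrite !size_cat /= scaler_sumr -big_split /=; apply: eq_bigr => i _.
rewrite !take_cat !drop_cat; case: ltnP => [_|le] /=.
  by rewrite word_multilinear.2 tr.
case: (i - size u)%N => [|k] /=; first by rewrite (word_multilinear.2 [::]) tr.
by rewrite word_multilinear.2 tl.
Qed.

Lemma deconc_word (w : seq A) :
  deconc (word w) =
  \sum_(1 <= i < size w) tens (word (take i w)) (word (drop i w)).
Proof. exact: (ulift_gen w deconc_multilinear). Qed.

Lemma deconc_linear : linear (@deconc F A).
Proof. exact: ulift_linear deconc_multilinear. Qed.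

(** [x (x) t]; the empty word is sent to [0] because admissible maps vanish on
it. *)
Definition tcons (x : A) (t : tcoalg A) : tcoalg A :=
  ulift (fun w : seq A => if w is [::] then 0 else word (x :: w)) t.

Lemma tcons_multilinear x :
  multilinear_map (fun w : seq A => if w is [::] then 0 else word (x :: w)).
Proof.
split=> // u v c y z; have := word_multilinear.2 (x :: u) v c y z.
by case: u.
Qed.

Lemma tcons_word x y w : tcons x (word (y :: w)) = word [:: x, y & w].
Proof. exact: (ulift_gen (y :: w) (tcons_multilinear x)). Qed.

Lemma tcons_linear x : linear (tcons x).
Proof. exact: ulift_linear (tcons_multilinear x). Qed.

Lemma tcons_linear_l (t : tcoalg A) : linear (tcons^~ t).
Proof.
move=> c x y; pose h t := c *: tcons x t + tcons y t.
apply: (umod_ext (h' := h)) t => [|a s t|[|z w]].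
- exact: tcons_linear.
- rewrite /h !tcons_linear !scalerDr !scalerA [c * a]mulrC -!addrA.
  by congr (_ + _); rewrite addrCA.
- rewrite /h (word_multilinear.1 : ugen _ [::] = 0).
  by rewrite /tcons !ulift_at0 ?scaler0 ?addr0 //; exact: tcons_multilinear.
rewrite /h -!/(word _) !tcons_word; exact: (word_multilinear.2 [::]).
Qed.

(** Undoes [deconc] by keeping only the cut after the first letter.
Concatenating both factors instead would multiply a word by its number of
cuts, which may vanish in [F]. *)
Definition assemble (z : tensor (tcoalg A) (tcoalg A)) : tcoalg A :=
  ulift (fun p : tcoalg A * tcoalg A => tcons (tproj1 p.1) p.2) z.

Lemma assemble_bilinear :
  bilinear_map (fun p : tcoalg A * tcoalg A => tcons (tproj1 p.1) p.2).
Proof.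
split=> c u u' v /=; last exact: tcons_linear.
by rewrite tproj1_linear tcons_linear_l.
Qed.

Lemma assemble_tens s t : assemble (tens s t) = tcons (tproj1 s) t.
Proof. exact: (ulift_gen (s, t) assemble_bilinear). Qed.

Lemma assemble_linear : linear assemble.
Proof. exact: ulift_linear assemble_bilinear. Qed.

End TensorCoalgebra.

(** The cut after the first letter recovers any word of length at least two,
and a word of length one is its own projection.  This is the cofreeness of the
tensor coalgebra: an element is determined by its projection and its
coproduct. *)
Lemma tcoalg_split (F : fieldType) (A : lmodType F) (t : tcoalg A) :
  t = word [:: tproj1 t] + assemble (deconc t).
Proof.
pose h (t : tcoalg A) := word [:: tproj1 t] + assemble (deconc t).
apply: (umod_ext (h := id) (h' := h)) t => // [c s t|w].
  rewrite /h tproj1_linear deconc_linear assemble_linear.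
  rewrite ((word_multilinear A).2 [::]) scalerDr -!addrA; congr (_ + _).
  by rewrite addrCA.
have word0 : word [:: 0] = 0 :> tcoalg A.
  apply: (linear_at0 (h := fun x : A => word [:: x])) => c x y.
  exact: ((word_multilinear A).2 [::] [::]).
rewrite /h -/(word w) tproj1_word deconc_word (linear_sum (@assemble_linear F A)).
case: w => [|x [|y w]].
- by rewrite big_geq // addr0 (word_multilinear A).1 word0.
- by rewrite big_geq // addr0.
rewrite word0 add0r big_ltn // big_nat big1 ?addr0.
  by rewrite assemble_tens tproj1_word drop1 /= tcons_word.
move=> [|[|i]] // _; rewrite assemble_tens tproj1_word /=.
exact: linear_at0 (tcons_linear_l _).
Qed.

(** * Koszul signs *)

Section Graded.
Variables (F : fieldType) (A : graded F).
Implicit Types (x y : A).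

Lemma hom_linear i c x y : hom i x -> hom i y -> hom i (c *: x + y).
Proof. by rewrite /hom /= linearP => -> ->. Qed.

Lemma hom0 i : hom i (0 : A).
Proof. by rewrite /hom /= linear0. Qed.

Lemma homZ i c x : hom i x -> hom i (c *: x).
Proof. by move=> hx; rewrite -[_ *: x]addr0; apply/hom_linear/hom0. Qed.

Lemma homD i x y : hom i x -> hom i y -> hom i (x + y).
Proof. by move=> hx hy; rewrite -[x]scale1r; exact: hom_linear. Qed.

Lemma homN i x : hom i x -> hom i (- x).
Proof. by rewrite -scaleN1r; exact: homZ. Qed.

Lemma homB i x y : hom i x -> hom i y -> hom i (x - y).
Proof. by move=> hx hy; apply/homD/homN. Qed.

(** [koszul] sums over the support of its argument; additivity needs one finite
index set common to several arguments. *)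
Lemma koszul_finite p x (E : set int) :
  finite_set E -> (forall i, ~ E i -> gr_proj A i x = 0) ->
  koszul p x = \sum_(i \in E) (-1) ^+ `|(p * i)%R|%N *: gr_proj A i x.
Proof.
move=> fE out; rewrite /koszul; apply/esym/fsbig_widen => // i [_ /out] /= ->.
by rewrite scaler0.
Qed.

Lemma koszul_linear p : linear (@koszul F A p).
Proof.
move=> c x y; pose E z := [set i | gr_proj A i z != 0].
have fE : finite_set (E x `|` E y) by rewrite finite_setU; split; apply: gr_fin.
have out i : ~ (E x `|` E y) i -> gr_proj A i x = 0 /\ gr_proj A i y = 0.
  by move=> h; split; apply: contra_notP h => /eqP; [left|right].
rewrite (koszul_finite (x := x) p fE); last by move=> i /out[].
rewrite (koszul_finite (x := y) p fE); last by move=> i /out[].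
rewrite (koszul_finite (x := c *: x + y) p fE); last first.
  by move=> i /out[h h']; rewrite linearP h h' scaler0 addr0.
rewrite !fsbig_finite // scaler_sumr -big_split /=; apply: eq_bigr => i _.
by rewrite linearP scalerDr !scalerA [c * _]mulrC.
Qed.

Lemma koszul_hom p i x : hom i x -> koszul p x = (-1) ^+ `|(p * i)%R|%N *: x.
Proof.
move=> hx; rewrite (@koszul_finite p x [set i]) ?fsbig_set1 ?hx // => j ji.
by rewrite -hx gr_projK; case: eqP ji.
Qed.

Lemma koszul0 p : koszul p (0 : A) = 0.
Proof. by rewrite (koszul_hom _ (hom0 0)) scaler0. Qed.

Lemma koszul_of_degree0 x : koszul 0 x = x.
Proof.
rewrite [RHS]gr_sum /koszul; apply: eq_fsbigr => i _.
by rewrite mul0r expr0 scale1r.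
Qed.

End Graded.

(** * A coderivation on words of length at most three *)

Section Coderivation.
Variables (F : fieldType) (A : graded F) (Q : {linear tcoalg A -> tcoalg A}).
Hypothesis Q_coder : coderivation1 Q.
Let S := structure_map Q.
Let wordM := word_multilinear A.

Lemma tkoszul_word p (w : seq A) : tkoszul p (word w) = word (map (koszul p) w).
Proof.
apply: ulift_gen; split=> [|u v c x y]; first exact: wordM.1.
by rewrite !map_cat /= koszul_linear wordM.2.
Qed.

Lemma tkoszul_linear p : linear (@tkoszul F A p).
Proof.
apply: ulift_linear; split=> [|u v c x y]; first exact: wordM.1.
by rewrite !map_cat /= koszul_linear wordM.2.
Qed.

Lemma coder_bilinear : bilinear_map (fun p : tcoalg A * tcoalg A =>
  tens (Q p.1) p.2 + tens (tkoszul 1 p.1) (Q p.2)).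
Proof.
have [tl tr] := tens_bilinear (tcoalg A) (tcoalg A); rewrite /= in tl tr.
split=> c u u' v /=.
  by rewrite linearP tkoszul_linear !tl scalerDr addrACA.
by rewrite linearP !tr scalerDr addrACA.
Qed.

(** Split [Q (x y w)] with [tcoalg_split]: the coderivation rule gives its
coproduct, and keeping the cuts whose left factor projects to one letter leaves
the terms where [Q] absorbs a prefix and the one term where it passes over
[x]. *)
Lemma coder_rec (x y : A) (w : seq A) :
  Q (word [:: x, y & w]) =
  word [:: S [:: x, y & w]]
  + \sum_(1 <= i < (size w).+2)
      word (S (take i [:: x, y & w]) :: drop i [:: x, y & w])
  + tcons (koszul 1 x) (Q (word (y :: w))).
Proof.
rewrite {1}[LHS]tcoalg_split Q_coder deconc_word -addrA; congr (_ + _).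
rewrite (linear_sum (ulift_linear coder_bilinear)).
rewrite (linear_sum (@assemble_linear F A)).
under eq_bigr => i _.
  rewrite ulift_gen ?(assemble_linear 1, scale1r) //=; last exact: coder_bilinear.
  rewrite -[tens (Q _) _]scale1r assemble_linear scale1r !assemble_tens.
  rewrite tkoszul_word tproj1_word /=.
  over.
rewrite big_split /=; congr (_ + _).
  apply: eq_big_nat => i /andP[i0 ilt].
  rewrite -/(S _) -/(structure_map Q _).
  case: (drop i _) (size_drop i [:: x, y & w]) => [/esym/eqP|z v _]; last exact: tcons_word.
  by rewrite subn_eq0 leqNgt ilt.
(* A left factor of length at least two has no one-letter projection. *)
rewrite big_ltn // [X in _ + X]big_nat big1 ?addr0 // => -[|[|i]] // _ /=.
exact: linear_at0 (tcons_linear_l _).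
Qed.

Lemma coder_word1 x : Q (word [:: x]) = word [:: S [:: x]].
Proof.
rewrite {1}[LHS]tcoalg_split Q_coder deconc_word big_geq //.
rewrite (ulift_at0 coder_bilinear).
by rewrite [assemble _](ulift_at0 (@assemble_bilinear F A)) addr0.
Qed.

Lemma coder_word2 x y :
  Q (word [:: x; y]) =
  word [:: S [:: x; y]] + word [:: S [:: x]; y] + word [:: koszul 1 x; S [:: y]].
Proof. by rewrite coder_rec big_nat1 coder_word1 tcons_word. Qed.

Lemma coder_word3 x y z :
  Q (word [:: x; y; z]) =
  word [:: S [:: x; y; z]] +
  (word [:: S [:: x]; y; z] + word [:: S [:: x; y]; z]) +
  (word [:: koszul 1 x; S [:: y; z]] + word [:: koszul 1 x; S [:: y]; z]
   + word [:: koszul 1 x; koszul 1 y; S [:: z]]).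
Proof.
rewrite coder_rec big_ltn // big_nat1 coder_word2.
have tD u v : tcons (koszul 1 x) (u + v) = tcons (koszul 1 x) u + tcons (koszul 1 x) v.
  by rewrite -[u]scale1r tcons_linear !scale1r.
by rewrite !tD !tcons_word.
Qed.

Hypothesis QQ : forall t, Q (Q t) = 0.

Lemma tproj1_QD s t : tproj1 (Q (s + t)) = tproj1 (Q s) + tproj1 (Q t).
Proof. by rewrite linearD -[Q s]scale1r tproj1_linear !scale1r. Qed.

Lemma tproj1_0 : tproj1 (0 : tcoalg A) = 0.
Proof. exact: (ulift_at0 (tproj1_multilinear A)). Qed.

(** Project [Q (Q (x y)) = 0] to one letter. *)
Lemma ainf_rel2 x y :
  S [:: S [:: x; y]] + S [:: S [:: x]; y] + S [:: koszul 1 x; S [:: y]] = 0.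
Proof. by rewrite -tproj1_0 -(QQ (word [:: x; y])) coder_word2 !tproj1_QD. Qed.

Lemma ainf_rel3 x y z :
  S [:: S [:: x; y; z]] +
  (S [:: S [:: x]; y; z] + S [:: S [:: x; y]; z]) +
  (S [:: koszul 1 x; S [:: y; z]] + S [:: koszul 1 x; S [:: y]; z]
   + S [:: koszul 1 x; koszul 1 y; S [:: z]]) = 0.
Proof. by rewrite -tproj1_0 -(QQ (word [:: x; y; z])) coder_word3 !tproj1_QD. Qed.

End Coderivation.

(** * Quasi-multiplication on cohomology in degree -1 *)

Section Cohomology.
Variables (F : fieldType) (A : complete_ainf F).
Local Notation d := (cc_d A).
Local Notation S := (structure_map (ca_Q A)).
Local Notation m2 a b := (structure_map (ca_Q A) [:: a; b]).

Lemma structure_map_multilinear : multilinear_map S.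
Proof.
split=> [|u v c x y]; rewrite /structure_map.
  by rewrite (word_multilinear A).1 linear0 tproj1_0.
by rewrite (word_multilinear A).2 linearP tproj1_linear.
Qed.

Lemma structure_map_mem0 (w : seq A) : 0 \in w -> S w = 0.
Proof.
case/splitPr=> u v; apply: (linear_at0 (h := fun x : A => S (u ++ x :: v))).
by move=> c x y; exact: structure_map_multilinear.2.
Qed.

Lemma structure_map_hom k (w : seq A) : hom_word k w -> hom (k + 1) (S w).
Proof.
move=> hw; rewrite /structure_map; have [|s [hs ->]] := @ca_Q_deg _ A k (word w).
  exists [:: (1, w)]; split; last by rewrite big_seq1 scale1r.
  by move=> p; rewrite inE => /eqP ->.
elim: s hs => [|p s IH] hs.
  by rewrite big_nil tproj1_0; exact: hom0.
rewrite big_cons tproj1_linear; apply: hom_linear; last first.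
  by apply: IH => q qs; apply: hs; rewrite inE qs orbT.
have [[|i [|j ks]] [sz hh hsum]] := hs p (mem_head _ _); rewrite tproj1_word.
- by move: sz; case: p.2 => // _; exact: hom0.
- move: sz hh hsum; case: p.2 => [|x [|y w']] // _ /(_ 0%N isT) /=.
  by rewrite big_seq1 => hx <-.
by move: sz; case: p.2 => [|x [|y w']] // _; exact: hom0.
Qed.

Lemma m2_hom i j a b : hom i a -> hom j b -> hom (i + j + 1) (m2 a b).
Proof.
move=> ha hb; apply: structure_map_hom; exists [:: i; j]; split => //.
  by move=> [|[|]].
by rewrite big_cons big_seq1.
Qed.

Lemma m2_linear_l b : linear (fun a => m2 a b).
Proof. by move=> c x y; exact: (structure_map_multilinear.2 [::] [:: b]). Qed.

Lemma m2_linear_r a : linear (fun b => m2 a b).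
Proof. by move=> c x y; exact: (structure_map_multilinear.2 [:: a] [::]). Qed.

Lemma m20l b : m2 0 b = 0.
Proof. by apply: structure_map_mem0; rewrite inE eqxx. Qed.

Lemma m20r a : m2 a 0 = 0.
Proof. by apply: structure_map_mem0; rewrite !inE eqxx orbT. Qed.

Lemma m2Dl a a' b : m2 (a + a') b = m2 a b + m2 a' b.
Proof. by rewrite -[a]scale1r m2_linear_l !scale1r. Qed.

Lemma m2Dr a b b' : m2 a (b + b') = m2 a b + m2 a b'.
Proof. by rewrite -[b]scale1r m2_linear_r !scale1r. Qed.

Lemma m2Nl a b : m2 (- a) b = - m2 a b.
Proof. by rewrite -[- a]addr0 -scaleN1r m2_linear_l m20l addr0 scaleN1r. Qed.

Lemma m2Nr a b : m2 a (- b) = - m2 a b.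
Proof. by rewrite -[- b]addr0 -scaleN1r m2_linear_r m20r addr0 scaleN1r. Qed.

Lemma koszulN1 (a : A) : hom (- 1) a -> koszul 1 a = - a.
Proof. by move=> ha; rewrite (koszul_hom _ ha) scaleN1r. Qed.

Lemma leibniz a b : d (m2 a b) + m2 (d a) b + m2 (koszul 1 a) (d b) = 0.
Proof. by rewrite -!ca_Q1; apply: ainf_rel2; [exact: ca_Q_coder|exact: ca_QQ]. Qed.

Lemma m2_boundary_l c b : d b = 0 -> m2 (d c) b = - d (m2 c b).
Proof.
move=> db; have := leibniz c b; rewrite db m20r addr0 => /eqP.
by rewrite addrC addr_eq0 => /eqP.
Qed.

Lemma m2_boundary_r a c : hom (- 1) a -> d a = 0 -> m2 a (d c) = d (m2 a c).
Proof.
move=> ha da; have := leibniz a c; rewrite da m20l addr0 koszulN1 // m2Nl.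
by move/eqP; rewrite subr_eq0 => /eqP.
Qed.

Lemma m2_cocycle a b : hom (- 1) a -> d a = 0 -> d b = 0 -> d (m2 a b) = 0.
Proof. by move=> ha da db; rewrite -m2_boundary_r // db m20r. Qed.

(** On cocycles all terms of the ternary relation that contain a differential
of an argument vanish, so [Q^1_3] is a homotopy between the two bracketings.
The sign [-1] that moves [Q] past [a] turns the sum into a difference. *)
Lemma m2_assoc a b c : Zm1 A a -> Zm1 A b -> Zm1 A c ->
  m2 a (m2 b c) = m2 (m2 a b) c + d (S [:: a; b; c]).
Proof.
move=> [ha da] [hb db] [hc dc].
have := ainf_rel3 (@ca_Q_coder _ A) (@ca_QQ _ A) a b c.
rewrite !ca_Q1 da db dc !koszulN1 //.
have S0l x y : S [:: 0; x; y] = 0 by apply: structure_map_mem0; rewrite !inE eqxx.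
have S0m x y : S [:: x; 0; y] = 0.
  by apply: structure_map_mem0; rewrite !inE eqxx orbT.
have S0r x y : S [:: x; y; 0] = 0.
  by apply: structure_map_mem0; rewrite !inE eqxx !orbT.
rewrite S0l S0m S0r.
rewrite m2Nl !(addr0, add0r) => /eqP; rewrite subr_eq0 => /eqP <-.
by rewrite addrC.
Qed.

Lemma Zm1_linear k a b : Zm1 A a -> Zm1 A b -> Zm1 A (k *: a + b).
Proof.
move=> [ha da] [hb db]; split; first exact: hom_linear.
by rewrite linearP da db scaler0 addr0.
Qed.

Lemma Zm1_0 : Zm1 A 0.
Proof. by split; [exact: hom0|rewrite linear0]. Qed.

Lemma Zm1D a b : Zm1 A a -> Zm1 A b -> Zm1 A (a + b).
Proof. by move=> za zb; rewrite -[a]scale1r; exact: Zm1_linear. Qed.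

Lemma Zm1N a : Zm1 A a -> Zm1 A (- a).
Proof. by move=> za; rewrite -[- a]addr0 -scaleN1r; exact/Zm1_linear/Zm1_0. Qed.

Lemma Zm1_d c : hom (- 2) c -> Zm1 A (d c).
Proof. by move=> hc; split; [exact: (cc_d_deg hc)|rewrite cc_dd]. Qed.

Lemma Zm1_m2 a b : Zm1 A a -> Zm1 A b -> Zm1 A (m2 a b).
Proof.
move=> [ha da] [hb db]; split; last exact: m2_cocycle.
exact: (m2_hom ha hb).
Qed.

Lemma coh_refl a : coh A a a.
Proof. by exists 0; [exact: hom0|rewrite linear0 addr0]. Qed.

Lemma coh_boundary a c : hom (- 2) c -> coh A a (a + d c).
Proof. by move=> hc; exists c. Qed.

Lemma coh_sym a b : coh A a b -> coh A b a.
Proof. by case=> c hc ->; exists (- c); [exact: homN|rewrite linearN addrK]. Qed.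

Lemma coh_trans a b c : coh A a b -> coh A b c -> coh A a c.
Proof.
case=> u hu -> [v hv ->]; exists (u + v); first exact: homD.
by rewrite linearD addrA.
Qed.

Lemma coh_eqP a b : coh A a = coh A b <-> coh A a b.
Proof.
split=> [->|ab]; first exact: coh_refl.
apply/seteqP; split=> c; first exact/coh_trans/coh_sym.
exact: coh_trans.
Qed.

Lemma coh_D a a' b b' : coh A a a' -> coh A b b' -> coh A (a + b) (a' + b').
Proof.
case=> u hu -> [v hv ->]; exists (u + v); first exact: homD.
by rewrite linearD addrACA.
Qed.

Lemma coh_Zm1 a b : Zm1 A a -> coh A a b -> Zm1 A b.
Proof. by move=> za [c hc ->]; apply/Zm1D/Zm1_d. Qed.

Lemma coh_m2 a a' b b' : Zm1 A a -> Zm1 A b ->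
  coh A a a' -> coh A b b' -> coh A (m2 a b) (m2 a' b').
Proof.
move=> za zb aa' bb'; have [_ db'] := coh_Zm1 zb bb'.
case: aa' bb' db' => u hu -> [v hv ->] db'.
rewrite m2Dl m2_boundary_l // m2Dr m2_boundary_r; [|by case: za..].
rewrite -addrA -linearB; apply: coh_boundary; apply: homB.
  exact: (m2_hom za.1 hv).
apply: (m2_hom hu (j := - 1)); apply: homD; first exact: zb.1.
exact: (Zm1_d hv).1.
Qed.

Definition quasi (a b : A) : A := a + b + m2 a b.

Lemma Zm1_quasi a b : Zm1 A a -> Zm1 A b -> Zm1 A (quasi a b).
Proof. by move=> za zb; apply: Zm1D; [exact: Zm1D|exact: Zm1_m2]. Qed.

Lemma coh_quasi a a' b b' : Zm1 A a -> Zm1 A b ->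
  coh A a a' -> coh A b b' -> coh A (quasi a b) (quasi a' b').
Proof. by move=> za zb aa' bb'; apply: coh_D; [exact: coh_D|exact: coh_m2]. Qed.

Lemma quasi_mul_coh a b : Zm1 A a -> Zm1 A b ->
  quasi_mul A (coh A a) (coh A b) = coh A (quasi a b).
Proof.
move=> za zb; apply/seteqP; split=> z.
  case=> _ [a1 aa1 [b1 bb1 <-]] [m [a2 [b2 [aa2 bb2 zm]]] <-].
  apply: coh_D; first exact: coh_D.
  by apply: coh_trans zm; exact: coh_m2.
case=> c hc ->; exists (a + b).
  by exists a; [exact: coh_refl|exists b; [exact: coh_refl|]].
exists (m2 a b + d c); last by rewrite addrA.
exists a, b; split; [exact: coh_refl|exact: coh_refl|exact: coh_boundary].
Qed.

Lemma quasi0l a : quasi 0 a = a.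
Proof. by rewrite /quasi m20l addr0 add0r. Qed.

Lemma quasi0r a : quasi a 0 = a.
Proof. by rewrite /quasi m20r !addr0. Qed.

Lemma quasi_assoc a b c : Zm1 A a -> Zm1 A b -> Zm1 A c ->
  coh A (quasi (quasi a b) c) (quasi a (quasi b c)).
Proof.
move=> za zb zc; exists (S [:: a; b; c]).
  have := @structure_map_hom (- 3) [:: a; b; c]; apply.
  exists [:: - 1; - 1; - 1]; split=> //; last by rewrite !big_cons big_nil.
  by move=> [|[|[|]]] //= _; [exact: za.1|exact: zb.1|exact: zc.1].
rewrite /quasi !(m2Dl, m2Dr) m2_assoc // !addrA; congr (_ + _).
by rewrite [LHS](AC 7%N ((1*2*5*3*6*4*7)%AC)).
Qed.

End Cohomology.

(** * Completeness makes every class quasi-invertible *)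

Section Inverse.
Variables (F : fieldType) (A : complete_ainf F).
Local Notation d := (cc_d A).
Local Notation m2 a b := (structure_map (ca_Q A) [:: a; b]).

Lemma filtD n (x y : A) : cc_filt n x -> cc_filt n y -> cc_filt n (x + y).
Proof. by move=> hx hy; rewrite -[x]scale1r; exact: cc_filt_lin. Qed.

Lemma filtN n (x : A) : cc_filt n x -> cc_filt n (- x).
Proof.
move=> hx; rewrite -[- x]addr0 -scaleN1r.
by apply: cc_filt_lin => //; exact: cc_filt0.
Qed.

Lemma filt_m2 n (x y : A) :
  (0 < n)%N -> cc_filt n y -> cc_filt n.+1 (m2 x y).
Proof.
move=> n0 hy; have := @ca_Q_filt _ A [:: x; y] [:: 1%N; n].
rewrite /= addn0 add1n n0; apply=> // -[|[|]] //= _.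
by rewrite cc_filt1.
Qed.

(** The equation [a + b + a b = 0] asks for a fixed point of
[b |-> - a - a b].  This map raises the filtration degree of differences by
one, so its iterates from [0] converge, and they stay cocycles because [a] is
one. *)
Lemma quasi_right_inverse a : Zm1 A a -> exists2 b, Zm1 A b & quasi a b = 0.
Proof.
move=> za.
pose u n := iter n (fun b => - a - m2 a b) 0.
have subD p q : (- a - p) - (- a - q) = - (p - q).
  by rewrite opprD addrACA subrr add0r opprD.
have zu n : Zm1 A (u n).
  elim: n => [|n IH]; first exact: Zm1_0.
  by apply: Zm1D; apply: Zm1N => //; exact: Zm1_m2.
have uS n : cc_filt n (u n.+1 - u n).
  case: n => [|n]; first by apply: cc_filtS; rewrite cc_filt1.
  elim: n => [|n IH]; first by rewrite cc_filt1.
  have -> : u n.+3 - u n.+2 = - m2 a (u n.+2 - u n.+1).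
    by rewrite m2Dr m2Nr; exact: subD (m2 a (u n.+2)) (m2 a (u n.+1)).
  by apply/filtN/filt_m2.
have [b hb bu] := cc_lim_surj (fun n => (zu n).1) uS.
have db : d b = 0.
  apply: (@cc_lim_inj _ A (- 1 + 1)); first exact: cc_d_deg.
  move=> n; have := cc_filt_d (bu n).
  by rewrite linearB (zu n).2 subr0.
exists b; first by [].
apply: (@cc_lim_inj _ A (- 1)).
  by have [] := Zm1_quasi za (conj hb db).
case=> [|n]; first by apply: cc_filtS; rewrite cc_filt1.
(* The error terms of [b] against two consecutive iterates. *)
have -> : quasi a b = (b - u n.+2) + m2 a (b - u n.+1).
  rewrite m2Dr m2Nr /quasi (_ : u n.+2 = - a - m2 a (u n.+1)) //.
  rewrite opprB opprK [m2 a _ + a]addrC !addrA [b + a]addrC.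
  by rewrite [RHS]addrAC addrK.
apply: filtD; first exact: cc_filtS.
by apply: cc_filtS; apply: filt_m2.
Qed.

End Inverse.

Section Group.
Variables (F : fieldType) (A : complete_ainf F).

(** In a monoid where every element has a right inverse, a right inverse [y] of
[x] has a right inverse [z], and [z = (x y) z = x], so [y] is two-sided. *)
Lemma Hm1_group : is_group (Hm1 A) (quasi_mul A).
Proof.
have mulH a b : Zm1 A a -> Zm1 A b -> Hm1 A (coh A (quasi a b)).
  by move=> za zb; exists (quasi a b) => //; exact: Zm1_quasi.
have assoc x y z : Hm1 A x -> Hm1 A y -> Hm1 A z ->
    quasi_mul A x (quasi_mul A y z) = quasi_mul A (quasi_mul A x y) z.
  move=> [a za <-] [b zb <-] [c zc <-].
  rewrite !quasi_mul_coh //; [|exact: Zm1_quasi..].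
  by apply/esym/coh_eqP; exact: quasi_assoc.
have one : Hm1 A (coh A 0) by exists 0 => //; exact: Zm1_0.
have mul1 x : Hm1 A x -> quasi_mul A (coh A 0) x = x.
  by move=> [a za <-]; rewrite quasi_mul_coh ?quasi0l //; exact: Zm1_0.
have mulr1 x : Hm1 A x -> quasi_mul A x (coh A 0) = x.
  by move=> [a za <-]; rewrite quasi_mul_coh ?quasi0r //; exact: Zm1_0.
have inv x : Hm1 A x -> exists2 y, Hm1 A y & quasi_mul A x y = coh A 0.
  move=> [a za <-]; have [b zb ab] := quasi_right_inverse za.
  by exists (coh A b); [exists b|rewrite quasi_mul_coh // ab].
split=> //.
  by move=> _ _ [a za <-] [b zb <-]; rewrite quasi_mul_coh //; exact: mulH.
exists (coh A 0) => // x hx; split; [exact: mul1|exact: mulr1|].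
have [y hy xy] := inv x hx; exists y => //; split=> //.
have [z hz yz] := inv y hy.
by rewrite -[x in quasi_mul _ y x]mulr1 // -yz (assoc x) // xy mul1.
Qed.

Lemma Hm1_quasiE : Hm1_quasi A = Hm1 A.
Proof.
apply/seteqP; split=> x; first by case.
move=> hx; split=> //; have [_ _ [e he h]] := Hm1_group.
have [_ _ [y hy [xy yx]]] := h x hx.
have e0 : e = coh A 0.
  have [a za ea] := he; have z0 := Zm1_0 A.
  have [|e0 _ _] := h (coh A 0); first by exists 0.
  by move: e0; rewrite -ea quasi_mul_coh // quasi0r.
by exists y => //; rewrite xy yx e0.
Qed.

End Group.

(** Associativity, unit and inverses of the target come from the source. *)
Lemma group_iso_transport (T U : Type) (G : set T) (op : T -> T -> T)
    (H : set U) (op' : U -> U -> U) (f : T -> U) :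
  is_group G op -> set_bij G H f ->
  (forall x y, G x -> G y -> f (op x y) = op' (f x) (f y)) ->
  group_iso G op H op' f.
Proof.
move=> gG bij fM; split=> //; have [fH _ fsurj] := bij.
have [cl assoc [e ge hG]] := gG.
split.
- move=> _ _ /fsurj[x gx <-] /fsurj[y gy <-]; rewrite -fM //.
  by apply: fH; exact: cl.
- move=> _ _ _ /fsurj[x gx <-] /fsurj[y gy <-] /fsurj[z gz <-].
  by rewrite -!fM ?assoc //; exact: cl.
exists (f e); first exact: fH.
move=> _ /fsurj[x gx <-]; have [ex xe [y gy [xy yx]]] := hG x gx.
split; rewrite -?fM ?ex ?xe //.
by exists (f y); [exact: fH|rewrite -!fM // xy yx].
Qed.

(** * Simplices and cochains *)

Section Simplices.
Variable n : nat.
Implicit Types (s t : simplex n) (X : {set 'I_n.+1}).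

Lemma simplex_card s : (0 < #|val s|)%N.
Proof. by rewrite card_gt0; exact: (valP s). Qed.

Lemma setT_neq0 : [set: 'I_n.+1]%SET != finset.set0.
Proof. by apply/set0Pn; exists ord0. Qed.

Definition topsimplex : simplex n := Sub [set: 'I_n.+1]%SET setT_neq0.

Lemma topsimplexP s : (s == topsimplex) = (#|val s| == n.+1).
Proof.
rewrite -val_eqE /= eqEcard finset.subsetT cardsT card_ord /= eqn_leq.
by have := max_card (mem (val s)); rewrite card_ord => ->.
Qed.

Lemma cochain_at_val (V : nmodType) (f : {ffun simplex n -> V}) s :
  cochain_at f (val s) = f s.
Proof. by rewrite /cochain_at valK. Qed.

Lemma cochain_atP (V : nmodType) (f : {ffun simplex n -> V}) (P : V -> Prop) X :
  P 0 -> (forall s, val s = X -> P (f s)) -> P (cochain_at f X).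
Proof. by move=> P0 Ps; rewrite /cochain_at; case: insubP => //= s _; exact: Ps. Qed.

Lemma sum_simplex_at (F : fieldType) (V : lmodType F) (f : {ffun simplex n -> V}) X :
  \sum_s (X == val s)%:R *: f s = cochain_at f X.
Proof.
rewrite /cochain_at; case: insubP => [s _ <-|X0]; rewrite [RHS]/=.
  rewrite (bigD1 s) // eqxx scale1r big1 => [|t /negPf ts]; first exact: addr0.
  by rewrite (inj_eq val_inj) eq_sym ts mulr0n scale0r.
rewrite big1 // => s _; case: (X =P val s) X0 => [->|_ _]; last by rewrite mulr0n scale0r.
by rewrite (valP s).
Qed.

Lemma card_omit_vertex X i : (i < #|X|)%N -> #|omit_vertex X i| = #|X|.-1.
Proof.
move=> iX; rewrite (cardsD1 (nth ord0 (enum X) i) X).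
by rewrite -mem_enum mem_nth -?cardE.
Qed.

Lemma omit_vertex_setT (i : 'I_n.+1) :
  omit_vertex [set: 'I_n.+1]%SET i = [set~ i]%SET.
Proof.
rewrite /omit_vertex.
have -> : enum [set: 'I_n.+1]%SET = enum 'I_n.+1.
  by apply: eq_enum => j; rewrite finset.in_setT.
by rewrite nth_ord_enum; apply/setP => j; rewrite !inE andbT.
Qed.

(** The two halves of a cut share exactly the vertex [v]. *)
Lemma card_split_at X v : v \in X ->
  (#|[set w in X | (w <= v)%N]%SET| + #|[set w in X | (v <= w)%N]%SET| = #|X|.+1)%N.
Proof.
move=> vX; rewrite -cardsUI -[RHS]addn1 -(cards1 v); congr (_ + _)%N.
  by apply: eq_card => w; rewrite !inE -andb_orr leq_total andbT.
apply: eq_card => w; rewrite !inE; case: eqP => [->|wv].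
  by rewrite vX leqnn.
by apply/negbTE/negP=> /andP[/andP[_ h1] /andP[_ h2]]; apply: wv; apply/val_inj/anti_leq; rewrite h1.
Qed.

End Simplices.

Section Cochains.
Variables (F : fieldType) (n : nat).
Implicit Types phi psi : {ffun simplex n -> F}.

Lemma cup_support p q phi psi :
  (forall s, (dim s < p)%N -> phi s = 0) ->
  (forall s, (dim s < q)%N -> psi s = 0) ->
  forall t, (dim t < p + q)%N -> cup phi psi t = 0.
Proof.
move=> hphi hpsi t; rewrite ffunE => tpq; rewrite big1 // => v vt.
have := card_split_at vt.
move: [set w in val t | (w <= v)%N]%SET [set w in val t | (v <= w)%N]%SET => L R LR.
rewrite /cochain_at; case: insubP => [s _ sL|_]; last exact: mul0r.
case: insubP => [s' _ sR|_]; last exact: mulr0.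
case: (ltnP (dim s) p) => [/hphi phis|ps]; first by rewrite [oapp _ _ _]phis mul0r.
case: (ltnP (dim s') q) => [/hpsi psis|qs].
  by rewrite [oapp _ _ (Some s')]psis mulr0.
have := leq_add ps qs; rewrite leqNgt; case/negP; apply: leq_trans tpq.
move: LR (simplex_card s) (simplex_card s'); rewrite /dim sL sR.
case: #|L| => // l; case: #|R| => // r; rewrite addnS addSn /= => -[<-] _ _.
exact: leqnn.
Qed.

(** The cup product adds degrees, so a product of [k] positive-degree cochains
has nothing in dimensions below [k]. *)
Lemma dg_prod_support (s : seq (simplex n)) :
  all (fun i => (0 < dim i)%N) s ->
  forall t, (dim t < size s)%N ->
  dg_prod [seq dg_e (B := Ncochains F n) i | i <- s] t = 0.
Proof.
have e_supp i : (0 < dim i)%N ->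
    forall t, (dim t < 1)%N -> dg_e (B := Ncochains F n) i t = 0.
  by move=> i0 t; rewrite ffunE; case: eqP => [<-|//]; rewrite ltnS leqNgt i0.
have prod_supp (r : seq (simplex n)) : all (fun i => (0 < dim i)%N) r ->
    forall (b : {ffun simplex n -> F}) p,
    (forall t, (dim t < p)%N -> b t = 0) ->
    forall t, (dim t < p + size r)%N ->
    foldl (@dg_mul F (Ncochains F n)) b
      [seq dg_e (B := Ncochains F n) i | i <- r] t = 0.
  elim: r => [_ b p hb t|j r IH /= /andP[j0 all_r] b p hb].
    by rewrite addn0 => /hb.
  rewrite addnS -addSn -[p.+1]addn1; apply: (IH all_r) => t tp.
  exact: (cup_support hb (e_supp j j0)).
case: s => [|i s] //= /andP[i0 all_s].
rewrite -[(size s).+1]add1n; exact: (prod_supp s all_s _ _ (e_supp i i0)).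
Qed.

End Cochains.

(** * The Maurer-Cartan equation for elements vanishing on vertices *)

Section Curvature.
Variables (F : fieldType) (A : complete_ainf F) (n : nat).
Local Notation d := (cc_d A).
Local Notation S := (structure_map (ca_Q A)).
Local Notation N := (Ncochains F n).
Implicit Types (f g : {ffun simplex n -> A}) (s t : simplex n).

Lemma tensor_diffE f t :
  tensor_diff (B := N) f t =
  d (f t) + \sum_(i < #|val t|)
    (-1) ^+ i *: koszul 1 (cochain_at f (omit_vertex (val t) i)).
Proof.
rewrite /tensor_diff ffunE !sum_ffunE; congr (_ + _).
  rewrite (bigD1 t) // big1 => [|s /negPf st]; rewrite !ffunE.
    by rewrite eqxx scale1r Monoid.mulm1.
  by rewrite st mulr0n scale0r.
have kz : koszul 1 (0 : A) = 0 by exact: koszul0.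
transitivity (\sum_s \sum_(i < #|val t|)
    (-1) ^+ i *: ((omit_vertex (val t) i == val s)%:R *: koszul 1 (f s))).
  apply: eq_bigr => s _; rewrite !ffunE.
  under eq_bigr => s' _ do rewrite ffunE.
  rewrite (bigD1 s) //= [X in _ + X]big1 => [|s' /negPf ss'].
    rewrite eqxx mul1r addr0 scaler_suml.
    by apply: eq_bigr => i _; rewrite scalerA.
  by rewrite eq_sym ss' mul0r.
rewrite exchange_big; apply: eq_bigr => i _; rewrite -scaler_sumr; congr (_ *: _).
pose kf := [ffun s => koszul 1 (f s)].
transitivity (cochain_at kf (omit_vertex (val t) i)).
  by rewrite -(sum_simplex_at (F := F)); apply: eq_bigr => s _; rewrite ffunE.
by rewrite /cochain_at; case: insubP => [s _ _|_] /=; rewrite ?ffunE ?kz.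
Qed.

Lemma tensor_map2E f g t :
  tensor_map (B := N) [:: f; g] t =
  \sum_(v in val t)
    let L := [set w in val t | (w <= v)%N]%SET in
    let R := [set w in val t | (v <= w)%N]%SET in
    S [:: cochain_at f L; koszul (#|L|.-1)%:Z (cochain_at g R)].
Proof.
rewrite /tensor_map sum_ffunE /=.
pose h (p : simplex n * simplex n) : 2.-tuple (simplex n) := [tuple p.1; p.2].
rewrite (reindex h) /=; last first.
  exists (fun s : 2.-tuple _ => (tnth s ord0, tnth s ord_max)) => [[a b] _|s _] //.
  by apply/val_inj; case: s => -[|a [|b []]].
have wordE p : [seq koszul (\sum_(i < 2 | (i < j)%N) (dim (tnth (h p) i))%:Z)
    (nth 0 [:: f; g] j (tnth (h p) j)) | j : 'I_2]
    = [:: f p.1; koszul (dim p.1)%:Z (g p.2)].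
  rewrite /image_mem !enum_ordSl enum_ord0 /=.
  rewrite big_pred0_eq koszul_of_degree0.
  by rewrite big_mkcond !big_ord_recl big_ord0 /= addr0.
under eq_bigr => p _ do rewrite wordE !ffunE scaler_suml.
rewrite exchange_big; apply: eq_bigr => v vt /=.
(* The sets cut out by [v] contain [v], so they are simplices. *)
have ex (P : pred 'I_n.+1) : P v ->
    exists s, val s = [set w in val t | P w]%SET.
  move=> Pv; have X0 : [set w in val t | P w]%SET != finset.set0.
    by apply/set0Pn; exists v; rewrite !inE vt.
  by exists (exist (fun X : {set _} => X != finset.set0) _ X0).
have [a aL] := ex _ (leqnn v : (fun w : 'I_n.+1 => (w <= v)%N) v).
have [b bR] := ex _ (leqnn v : (fun w : 'I_n.+1 => (v <= w)%N) v).
(* Only the pair of faces cut out by [v] survives. *)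
rewrite -aL -bR !cochain_at_val (bigD1 (a, b)) // big1 => [|[a' b'] ne].
  by rewrite !cochain_at_val !ffunE !eqxx mulr1 scale1r; exact: addr0.
rewrite !cochain_at_val !ffunE; case: (a' =P a) ne => [->|_ _].
  by case: (b' =P b) => [->|_ _]; rewrite ?eqxx // mulr0 scale0r.
by rewrite mul0r scale0r.
Qed.

Definition vertex_free (f : {ffun simplex n -> A}) : Prop :=
  forall s, #|val s| = 1%N -> f s = 0.

Lemma cochain_at_small f (X : {set 'I_n.+1}) :
  vertex_free f -> (#|X| <= 1)%N -> cochain_at f X = 0.
Proof.
move=> vf X1; apply: (cochain_atP (P := fun x => x = 0)) => // s sX; apply: vf.
by apply/eqP; rewrite eqn_leq simplex_card sX X1.
Qed.

(** Every factor has positive cochain degree, and [Delta^n] carries no cochains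
above degree [n]. *)
Lemma tensor_map_vertex_free f k :
  vertex_free f -> (n < k.+2)%N -> tensor_map (B := N) (nseq k.+2 f) = 0.
Proof.
move=> vf nk; rewrite /tensor_map [nseq _ _]/=.
rewrite big1 // => s _.
have [all_s|] := boolP (all (fun i => (0 < dim i)%N) s).
  apply/ffunP => t; rewrite !ffunE.
  rewrite (_ : dg_prod _ t = 0) ?scale0r //; apply: dg_prod_support => //.
  rewrite size_tuple /= size_nseq.
  apply: leq_ltn_trans nk; rewrite /dim -ltnS prednK ?simplex_card //.
  by rewrite -[X in (_ <= X)%N]card_ord max_card.
case/allPn => i /tnthP[j ->] jdim.
rewrite structure_map_mem0; first by apply/ffunP=> t; rewrite !ffunE scaler0.
apply/mapP; exists j; first by rewrite mem_enum.
rewrite (_ : nth _ _ _ = f).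
  rewrite vf ?koszul0 //; move: jdim (simplex_card (tnth s j)); rewrite /dim.
  by case: #|_| => [|[|]].
have jk : (j < k.+2)%N by have := ltn_ord j; rewrite [X in (_ < X)%N]/= size_nseq.
by have := nth_nseq 0 k.+2 f j; rewrite jk.
Qed.

Lemma tensor_map2_small f t :
  vertex_free f -> (#|val t| <= 2)%N -> tensor_map (B := N) [:: f; f] t = 0.
Proof.
move=> vf t2; rewrite tensor_map2E big1 // => v vt; apply: structure_map_mem0.
have := card_split_at vt; rewrite !inE.
set L := [set w in _ | _]%SET; set R := [set w in _ | _]%SET => LR.
case: (leqP #|L| 1) => [L1|L2]; first by rewrite cochain_at_small ?eqxx.
have R1 : (#|R| <= 1)%N.
  by rewrite -(leq_add2l 2) (leq_trans (leq_add L2 (leqnn _))) // LR.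
by rewrite [cochain_at f R]cochain_at_small // koszul0 eqxx orbT.
Qed.

Lemma tensor_diff_small f t :
  vertex_free f -> (#|val t| <= 2)%N -> tensor_diff (B := N) f t = d (f t).
Proof.
move=> vf t2; rewrite tensor_diffE big1 ?addr0 // => i _.
rewrite cochain_at_small ?koszul0 ?scaler0 // card_omit_vertex //.
by rewrite -ltnS prednK ?simplex_card.
Qed.

(** The filtration steps are graded, so separatedness in each degree gives
separatedness of the total space. *)
Lemma filt_separated (x : A) : (forall k, cc_filt k x) -> x = 0.
Proof.
move=> hx; rewrite [x]gr_sum fsbig1 // => i _; apply: (@cc_lim_inj _ A i).
  by rewrite /hom /= gr_projK eqxx.
by move=> k; exact: cc_filt_gr.
Qed.

(** In dimension at most two, operations of arity three and more vanish on
elements that are zero on all vertices, so the Maurer-Cartan series is a finite sum; its limit is unique because the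
filtration is separated. *)
Lemma nerveP f : (n <= 2)%N -> vertex_free f ->
  nerve (A := A) (n := n) f <->
  (forall s, hom (0 - (dim s)%:Z) (f s)) /\
  (forall t, tensor_diff (B := N) f t + tensor_map (B := N) [:: f; f] t = 0).
Proof.
move=> n2 vf.
have sumE m : (1 < m)%N ->
    \sum_(1 <= k < m.+1) tensor_map (B := N) (nseq k f) =
    tensor_diff (B := N) f + tensor_map (B := N) [:: f; f].
  move=> m1; rewrite big_ltn ?ltnS 1?ltnW //.
  rewrite big_ltn // big_nat big1 => [|[|[|[|k]]] //= _]; first by rewrite addr0.
  by apply: (tensor_map_vertex_free (k := k.+1)) => //; exact: leq_ltn_trans n2 _.
split=> -[hf mc]; split=> //.
  move=> t; apply: filt_separated => k; have [M hM] := mc k.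
  have := hM (maxn M 2) (leq_maxl _ _) t.
  by rewrite /= sumE ?leq_maxr // subr0 ffunE.
move=> k; exists 2%N => m m1 t; rewrite /= sumE // subr0 ffunE mc.
exact: cc_filt0.
Qed.

End Curvature.

(** * Loops are cocycles of degree -1 *)

Section Faces.
Variables (F : fieldType) (A : complete_ainf F) (n : nat).
Implicit Types (f : {ffun simplex n.+1 -> A}) (i : 'I_n.+2).

Lemma face_at f i (s : simplex n) :
  face (A := A) i f s = cochain_at f (lift i @: val s)%SET.
Proof. by rewrite ffunE card_imset ?eqxx //; exact: lift_inj. Qed.

Lemma face_top f i :
  face (A := A) i f (topsimplex n) = cochain_at f [set~ i]%SET.
Proof.
rewrite face_at; congr cochain_at; apply/setP => j; rewrite !inE.
apply/imsetP/idP => [[k _ ->]|ji]; first by rewrite eq_sym neq_lift.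
rewrite eq_sym in ji; have [k jk _] := unlift_some ji.
by exists k; rewrite ?inE.
Qed.

Lemma face_vertex_free f i :
  vertex_free f -> vertex_free (face (A := A) i f).
Proof.
move=> vf s s1; rewrite face_at; apply: cochain_at_small => //.
by rewrite card_imset ?s1 //; exact: lift_inj.
Qed.

(** A vertex [v] lies on the face opposite to any other vertex [h v]. *)
Lemma vertex_free_faces f (h : 'I_n.+2 -> 'I_n.+2) :
  (forall v, h v != v) ->
  (forall v, vertex_free (face (A := A) (h v) f)) -> vertex_free f.
Proof.
move=> hv vf s /eqP/cards1P[v sv]; have [k vk _] := unlift_some (hv v).
have k0 : [set k]%SET != finset.set0 by apply/set0Pn; exists k; rewrite inE.
pose s' : simplex n := exist (fun X : {set _} => X != finset.set0) _ k0.
have := vf v s' (cards1 k); rewrite face_at /= imset_set1 -vk -sv.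
by rewrite cochain_at_val.
Qed.

End Faces.

Local Notation loop_of a := (pure (B := Ncochains _ 1) a (phi_top _ 1)).

Section Loops.
Variables (F : fieldType) (A : complete_ainf F).
Local Notation d := (cc_d A).
Local Notation m2 a b := (structure_map (ca_Q A) [:: a; b]).

Lemma dim_top n : dim (topsimplex n) = n.
Proof. by rewrite /dim cardsT card_ord. Qed.

Lemma loop_of_top (a : A) : loop_of a (topsimplex 1) = a.
Proof. by rewrite !ffunE eqxx scale1r. Qed.

Lemma loop_of_ntop (a : A) s : s != topsimplex 1 -> loop_of a s = 0.
Proof.
by rewrite -val_eqE /= => /negPf st; rewrite !ffunE st scale0r.
Qed.

Lemma loop_of_vertex_free (a : A) : vertex_free (loop_of a).
Proof. by move=> s s1; apply: loop_of_ntop; rewrite topsimplexP s1. Qed.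

Lemma loop_of_inj : injective (fun a : A => loop_of a).
Proof. by move=> a b ab; rewrite -[a]loop_of_top ab loop_of_top. Qed.

Lemma vertex_free_loop_of (f : {ffun simplex 1 -> A}) :
  vertex_free f -> f = loop_of (f (topsimplex 1)).
Proof.
move=> vf; apply/ffunP => s; have [->|st] := eqVneq s (topsimplex 1).
  by rewrite loop_of_top.
rewrite loop_of_ntop // vf //; apply/eqP; move: st (simplex_card s) (max_card (mem (val s))).
by rewrite topsimplexP card_ord; case: #|_| => [|[|[|]]].
Qed.

Lemma simplex1_card (s : simplex 1) : (#|val s| <= 2)%N.
Proof. by have := max_card (mem (val s)); rewrite card_ord. Qed.

(** The two faces of a [1]-simplex are its vertices, so a loop is concentrated on
the top simplex.  There the Maurer-Cartan equation reduces to [d a = 0],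
because [phi_top] has square zero and is closed. *)
Lemma loopP (b : AN A 1) : loop b <-> exists2 a, Zm1 A a & b = loop_of a.
Proof.
split=> [[nb b0 b1]|[a [ha da] ->]].
  have vb : vertex_free b.
    apply: (vertex_free_faces (h := fun v => if v == 0 then 1 else 0)).
      by case=> -[|[|]].
    move=> v s s1; case: ifP => _.
      by rewrite (_ : 1 = inord 1) ?b1 ?ffunE //; apply/val_inj; rewrite /= inordK.
    by rewrite (_ : 0 = inord 0) ?b0 ?ffunE //; apply/val_inj; rewrite /= inordK.
  have [hb mc] := (nerveP (leqnSn 1) vb).1 nb.
  exists (b (topsimplex 1)); last exact: vertex_free_loop_of.
  split; first by have := hb (topsimplex 1); rewrite dim_top.
  have := mc (topsimplex 1).
  by rewrite tensor_map2_small ?tensor_diff_small ?addr0 ?simplex1_card.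
have face0 i : face (A := A) (n := 0) i (loop_of a) = 0.
  apply/ffunP => s; rewrite (face_vertex_free _ (@loop_of_vertex_free a)) ?ffunE //.
  by apply/eqP; rewrite eqn_leq simplex_card -[X in (_ <= X)%N](card_ord 1) max_card.
split=> //; apply/(nerveP (leqnSn 1) (@loop_of_vertex_free a)); split=> s.
  have [->|st] := eqVneq s (topsimplex 1); first by rewrite loop_of_top dim_top.
  by rewrite loop_of_ntop //; exact: hom0.
have va := @loop_of_vertex_free a.
rewrite tensor_map2_small ?tensor_diff_small ?addr0 ?simplex1_card //.
have [->|st] := eqVneq s (topsimplex 1); first by rewrite loop_of_top.
by rewrite loop_of_ntop // linear0.
Qed.

End Loops.

(** * Triangles compute the fundamental group *)

Section Triangles.
Variables (F : fieldType) (A : complete_ainf F).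
Local Notation d := (cc_d A).
Local Notation m2 a b := (structure_map (ca_Q A) [:: a; b]).
Local Notation top := (topsimplex 2).
(* The edge opposite to vertex [k]. *)
Local Notation edge f k := (cochain_at f [set~ inord k]%SET).

Lemma card_edge (i : 'I_3) : #|[set~ i]%SET| = 2%N.
Proof. by rewrite cardsC1 card_ord. Qed.

(** Cutting the triangle at vertex [0] or [2] leaves a vertex on one side, so
only the cut at vertex [1] contributes. *)
Lemma tensor_map2_triangle (f : {ffun simplex 2 -> A}) : vertex_free f ->
  tensor_map (B := Ncochains F 2) [:: f; f] top =
  m2 (edge f 2) (koszul 1 (edge f 0)).
Proof.
move=> vf; rewrite tensor_map2E (bigD1 (inord 1)) ?inE //= big1 => [|v /andP[_ v1]].
  rewrite addr0.
  have -> : [set w in [set: 'I_3] | (w <= (inord 1 : 'I_3))%N]%SET = [set~ inord 2]%SET.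
    by apply/setP => w; rewrite !inE -val_eqE /= !inordK //; case: w => -[|[|[|]]].
  have -> : [set w in [set: 'I_3] | ((inord 1 : 'I_3) <= w)%N]%SET = [set~ inord 0]%SET.
    by apply/setP => w; rewrite !inE -val_eqE /= !inordK //; case: w => -[|[|[|]]].
  by rewrite card_edge.
apply: structure_map_mem0; rewrite !inE.
have small (X : {set 'I_3}) : (forall w, w \in X -> w = v) -> cochain_at f X = 0.
  move=> Xv; apply: cochain_at_small => //.
  suff /subset_leq_card : X \subset [set v]%SET by rewrite cards1.
  by apply/fintype.subsetP => w /Xv ->; rewrite inE.
have [v0|v2] : v = 0%N :> nat \/ v = 2%N :> nat.
  by move: v1; rewrite -val_eqE /= inordK //; case: v small => -[|[|[|]]] //; [left|right].
  rewrite small ?eqxx // => w; rewrite !inE v0 leqn0 => /eqP w0.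
  by apply/val_inj; rewrite /= v0.
rewrite [X in koszul _ X]small ?koszul0 ?eqxx ?orbT // => w; rewrite !inE v2 /= => w2.
by apply/val_inj/anti_leq; rewrite /= v2 w2 andbT -ltnS ltn_ord.
Qed.

(** The edges have degree -1: the Koszul signs negate the alternating sum of the
edges and the binary term, which assembles [- (a + b + a b)] with [a] and [b]
the edges [01] and [12]. *)
Lemma triangle_curvature (f : {ffun simplex 2 -> A}) :
  vertex_free f -> (forall k, (k < 3)%N -> hom (- 1) (edge f k)) ->
  tensor_diff (B := Ncochains F 2) f top +
  tensor_map (B := Ncochains F 2) [:: f; f] top =
  d (f top) + edge f 1 - quasi (edge f 2) (edge f 0).
Proof.
move=> vf hf; rewrite tensor_map2_triangle // tensor_diffE.
rewrite -(big_mkord xpredT (fun i => (-1) ^+ i *: koszul 1 (cochain_at f (omit_vertex (val top) i)))).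
rewrite cardsT card_ord big_mkord.
have oE (i : 'I_3) : cochain_at f (omit_vertex (val top) i) = edge f i.
  by rewrite omit_vertex_setT inord_val.
rewrite (eq_bigr (fun i : 'I_3 => (-1) ^+ i *: - edge f i)) => [|i _]; last first.
  by rewrite oE koszulN1 //; exact: hf.
rewrite !big_ord_recr big_ord0 /= koszulN1 ?m2Nr; last exact: hf.
rewrite add0r expr0 expr1 expr2 mulrN1 opprK !scaleN1r !scale1r opprK.
rewrite /quasi !opprD !addrA.
by rewrite [LHS](AC 5%N ((1*3*4*2*5)%AC)).
Qed.

(** The equation on the top simplex says that the middle edge differs from
[quasi a b] by the boundary of the filling [w top]; conversely any element of
[A^(-2)] can be chosen as filling. *)
Lemma triangleP a b (g : AN A 1) : Zm1 A a -> Zm1 A b ->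
  (exists2 w : AN A 2, nerve w &
    [/\ face (inord 2) w = loop_of a, face (inord 0) w = loop_of b &
        face (inord 1) w = g]) <->
  exists2 c, coh A (quasi a b) c & g = loop_of c.
Proof.
move=> za zb; split.
  case=> w nw [w2 w0 w1].
  have vw : vertex_free w.
    apply: (vertex_free_faces (h := fun v => if v == inord 0 then inord 2 else inord 0)).
      by move=> v; case: ifP => [/eqP ->|/negbT]; rewrite 1?eq_sym // -val_eqE /= !inordK.
    move=> v; case: ifP => _.
      by rewrite w2; exact: loop_of_vertex_free.
    by rewrite w0; exact: loop_of_vertex_free.
  have [hw mc] := (nerveP (leqnn 2) vw).1 nw.
  exists (edge w 1); last first.
    rewrite -w1 -face_top; apply: vertex_free_loop_of.
    exact: face_vertex_free.
  have hedge k : hom (- 1) (edge w k).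
    apply: (cochain_atP (P := fun x => hom (- 1) x)); first exact: hom0.
    by move=> s sE; have := hw s; rewrite /dim sE card_edge.
  exists (- w top); first by apply: homN; have := hw top; rewrite dim_top.
  have := mc top; rewrite triangle_curvature // -!face_top w2 w0 !loop_of_top.
  move/eqP; rewrite subr_eq0 => /eqP <-.
  by rewrite linearN addrC addKr.
case=> _ [c hc ->] ->.
set g' := quasi a b + d c.
(* The edge opposite to vertex [0], [1], [2] in turn. *)
pose h (i : 'I_3) := nth 0 [:: b; g'; a] i.
have zg : Zm1 A g' by apply: Zm1D; [exact: Zm1_quasi|exact: Zm1_d].
have zh i : Zm1 A (h i) by rewrite /h; case: i => -[|[|[|]]].
pose w : {ffun simplex 2 -> A} := [ffun s =>
  if s == top then - c else oapp h 0 [pick i | val s == [set~ i]%SET]].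
have w_top : w top = - c by rewrite ffunE eqxx.
have w_ntop s : s != top -> w s = 0 \/ (#|val s| = 2%N /\ Zm1 A (w s)).
  move=> /negPf st; rewrite ffunE st; case: pickP => [i /eqP si|_]; last by left.
  by right; rewrite si card_edge; split=> //; exact: zh.
have w_edge i : cochain_at w [set~ i]%SET = h i.
  have i0 : [set~ i]%SET != finset.set0 by rewrite -card_gt0 card_edge.
  rewrite /cochain_at insubT /= ffunE topsimplexP /= card_edge /=.
  case: pickP => [j /eqP|/(_ i)]; last by rewrite eqxx.
  by move/finset.setC_inj/finset.set1_inj ->.
have vw : vertex_free w.
  move=> s s1; have st : s != top by rewrite topsimplexP s1.
  by have [|[]] := w_ntop s st; rewrite ?s1.
have nw : nerve (A := A) (n := 2) w.
  apply/(nerveP (leqnn 2) vw); split=> s; have [->|st] := eqVneq s top.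
  - by rewrite w_top dim_top; exact: homN.
  - have [->|[s2 [hs _]]] := w_ntop s st; first exact: hom0.
    by rewrite /dim s2.
  - rewrite triangle_curvature // => [|k k3]; last by rewrite w_edge; exact: (zh _).1.
    rewrite w_top !w_edge /h /= !inordK //= /g' linearN.
    by rewrite [- _ + _]addrC addrK subrr.
  - have s2 : (#|val s| <= 2)%N.
      rewrite -ltnS ltn_neqAle -topsimplexP st /=.
      by have := max_card (mem (val s)); rewrite card_ord.
    rewrite tensor_map2_small // tensor_diff_small // addr0.
    by have [->|[_ [_ ->]]] := w_ntop s st; rewrite ?linear0.
have fE (i : 'I_3) : face (A := A) i w = loop_of (h i).
  rewrite [LHS]vertex_free_loop_of; last exact: face_vertex_free.
  by rewrite face_top w_edge.
by exists w => //; rewrite !fE /h /= !inordK.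
Qed.

(** A homotopy between loops is a triangle whose edge [01] is [0], and
[quasi 0 a = a]. *)
Lemma loop_class_loop_of a : Zm1 A a ->
  loop_class (loop_of a) = [set loop_of c | c in coh A a].
Proof.
move=> za; have z0 := Zm1_0 A.
have loop0 : loop_of (0 : A) = 0 by apply/ffunP => s; rewrite !ffunE scaler0.
apply/seteqP; split=> g.
  case=> _ [w nw [w0 w1 w2]].
  have [|c] := (triangleP g z0 za).1; first by exists w; rewrite ?loop0.
  by rewrite quasi0l => ac ->; exists c.
case=> c ac <-; split; first by apply/loopP; exists c => //; exact: coh_Zm1 ac.
have [|w nw [w2 w0 w1]] := (triangleP (loop_of c) z0 za).2.
  by exists c => //; rewrite quasi0l.
by exists w => //; rewrite w2 loop0.
Qed.

Lemma pi1_mul_loop_of a b : Zm1 A a -> Zm1 A b ->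
  pi1_mul A [set loop_of c | c in coh A a] [set loop_of c | c in coh A b] =
  [set loop_of c | c in coh A (quasi a b)].
Proof.
move=> za zb; apply/seteqP; split=> g.
  case=> w [nw [a' aa' w2] [b' bb' w0]].
  have za' := coh_Zm1 za aa'; have zb' := coh_Zm1 zb bb'.
  have [|c qc w1] := (triangleP (face (inord 1) w) za' zb').1; first by exists w.
  have zc := coh_Zm1 (Zm1_quasi za' zb') qc.
  rewrite w1 loop_class_loop_of // => -[e ce <-]; exists e => //.
  apply: coh_trans ce; apply: coh_trans qc; exact: coh_quasi.
case=> c qc <-.
have zc := coh_Zm1 (Zm1_quasi za zb) qc.
have [|w nw [w2 w0 w1]] := (triangleP (loop_of c) za zb).2; first by exists c.
exists w; split=> //.
- by exists a => //; exact: coh_refl.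
- by exists b => //; exact: coh_refl.
rewrite w1 loop_class_loop_of //; exists c => //; exact: coh_refl.
Qed.

End Triangles.

Theorem theorem7p7 (F : fieldType) (A : complete_ainf F) :
  exists f : set A -> set (AN A 1),
    (forall a : A, Zm1 A a -> f (coh A a) = chi1 A a) /\
    group_iso (Hm1_quasi A) (quasi_mul A) (pi1 A) (pi1_mul A) f.
Proof.
exists (fun x => [set loop_of a | a in x]).
split=> [a za|]; first by rewrite -loop_class_loop_of.
rewrite Hm1_quasiE; apply: group_iso_transport; first exact: Hm1_group.
  split.
  - move=> _ [a za <-]; exists (loop_of a).
      by apply/loopP; exists a.
    exact: loop_class_loop_of.
  - move=> x y _ _ xy; apply/funext => a.
    by rewrite -(image_inj (@loop_of_inj F A)) [LHS](congr1 (@^~ _) xy) image_inj //;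
      exact: loop_of_inj.
  - move=> _ [b /loopP[a za ->] <-]; exists (coh A a); first by exists a.
    by rewrite loop_class_loop_of.
move=> _ _ [a za <-] [b zb <-].
by rewrite quasi_mul_coh // pi1_mul_loop_of.
Qed.
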